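(* For all integers $k \geq 2$ and $n \geq 1$, for every graph $G$ with $\mathrm{td}_2(G) \leq k$, if $G$ contains $P_n$ as a subgraph, then $G$ contains a path of order at least $n^{1/(k-1)}/2$ as an induced subgraph.
   Context: Graphs are finite and simple; the null graph has no vertices; connected graphs have at least one vertex. $P_n$ denotes the path on $n$ vertices; the order of a path is its number of vertices. A cut-vertex of a graph $G$ is a vertex $v$ such that $G-v$ has more components than $G$. A block of $G$ is a maximal connected subgraph of $G$ without a cut-vertex (so blocks are maximal 2-connected subgraphs, cut edges with their endpoints, or isolated vertices). ''$G$ is a block'' means that $G$ is connected and has no cut-vertex. 2-treedepth $\mathrm{td}_2(G)$ is defined recursively: $\mathrm{td}_2(G)=0$ if $G$ is the null graph; $\mathrm{td}_2(G)=\min_{v\in V(G)}\mathrm{td}_2(G-v)+1$ if $G$ is a block; $\mathrm{td}_2(G)=\max_i \mathrm{td}_2(B_i)$ if $G$ has blocks $B_1,\dots,B_m$ with $m>1$. *)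

(* Defs.v *)
From HB Require Import structures.
From mathcomp Require Import all_boot.

Set Implicit Arguments.
Unset Strict Implicit.
Unset Printing Implicit Defensive.

(* An edge {x, y} is stored as the two ordered pairs (x, y) and (y, x).
   The vertices are a subset of an ambient finite type, so that the subgraphs
   of a graph (induced or not) live in the same finite type sgraph T. *)
Definition sgraph_axiom (T : finType) (VE : {set T} * {set T * T}) : bool :=
  [forall x, forall y, ((x, y) \in VE.2) ==>
     [&& x \in VE.1, y \in VE.1, x != y & (y, x) \in VE.2]].

Record sgraph (T : finType) := SGraph {
  sgraph_val :> {set T} * {set T * T};
  sgraphP : sgraph_axiom sgraph_val }.

HB.instance Definition _ (T : finType) := [isSub for @sgraph_val T].
HB.instance Definition _ (T : finType) := [Finite of sgraph T by <:].

Section Graphs.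
Variable T : finType.
Implicit Types (G H B : sgraph T) (A : {set T}) (v x y : T).

Definition vertices G : {set T} := (sgraph_val G).1.
Definition edges G : {set T * T} := (sgraph_val G).2.
Definition adj G : rel T := fun x y => (x, y) \in edges G.

Definition subgraph H G : bool :=
  (vertices H \subset vertices G) && (edges H \subset edges G).

Fact induced_axiom G A :
  sgraph_axiom (vertices G :&: A,
                [set p in edges G | (p.1 \in A) && (p.2 \in A)]).
Proof.
apply/forallP=> x; apply/forallP=> y; apply/implyP; rewrite !inE /=.
case/and3P=> xy xA yA; have /forallP/(_ x)/forallP/(_ y) := sgraphP G.
rewrite -/(edges G) -/(vertices G) xy /= => /and4P[-> -> -> yx].
by rewrite xA yA andbT [(y, x) \in _]yx.
Qed.

Definition induced G A : sgraph T := SGraph (induced_axiom G A).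

Definition del_vertex G v : sgraph T := induced G (~: [set v]).

Definition ncomponents G : nat := n_comp (adj G) (vertices G).

(* In particular the null graph is not connected. *)
Definition connected_graph G : bool := ncomponents G == 1.

Definition cut_vertex G v : bool :=
  (v \in vertices G) && (ncomponents G < ncomponents (del_vertex G v)).

Definition is_block G : bool :=
  connected_graph G && [forall v, ~~ cut_vertex G v].

Definition blocks G : {set sgraph T} :=
  [set B | [&& subgraph B G, is_block B &
     [forall B', [&& subgraph B' G, is_block B' & subgraph B B']
                 ==> (B' == B)]]].

(* Every recursive call is on a graph with fewer vertices, so d need only be
   at least the number of vertices.  The idx argument of the minimum is one of
   the values being minimised; see td2_null, td2_block and td2_blocks. *)
Fixpoint td2_rec (d : nat) (G : sgraph T) : nat :=
  if d is d'.+1 then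
    if [pick v in vertices G] is Some v0 then
      if is_block G then
        (\big[minn/td2_rec d' (del_vertex G v0)]_(v in vertices G)
            td2_rec d' (del_vertex G v)).+1
      else \max_(B in blocks G) td2_rec d' B
    else 0
  else 0.

Definition td2 G : nat := td2_rec #|vertices G| G.

Lemma adj_vertices G x y :
  adj G x y -> [&& x \in vertices G, y \in vertices G, x != y & adj G y x].
Proof. by have /forallP/(_ x)/forallP/(_ y)/implyP := sgraphP G. Qed.

Lemma connect_adj_sym G : connect_sym (adj G).
Proof.
by apply: sym_connect_sym => x y; apply/idP/idP => /adj_vertices/and4P[].
Qed.

Lemma ncomponentsE G :
  ncomponents G = #|[set x in vertices G | root (adj G) x == x]|.
Proof.
rewrite /ncomponents /n_comp_mem.
by apply: eq_card => x; rewrite !inE andbC.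
Qed.

Lemma root_vertices G x : (root (adj G) x \in vertices G) = (x \in vertices G).
Proof.
have closedV : closed (adj G) (vertices G).
  by move=> a b /adj_vertices/and4P[-> ->].
by rewrite -(closed_connect closedV (connect_root _ x)).
Qed.

Lemma ncomponents_gt0 G : (0 < ncomponents G) = (vertices G != set0).
Proof.
rewrite ncomponentsE card_gt0; apply/set0Pn/set0Pn=> -[x].
  by rewrite inE => /andP[xG _]; exists x.
move=> xG; exists (root (adj G) x); rewrite inE root_vertices xG.
by rewrite (root_root (@connect_adj_sym G)) eqxx.
Qed.

Lemma leq_ncomponents H G :
  vertices H = vertices G -> edges H \subset edges G ->
  ncomponents G <= ncomponents H.
Proof.
move=> eqV /subsetP sE; rewrite !ncomponentsE.
have sub x y : connect (adj H) x y -> connect (adj G) x y.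
  by apply: connect_sub => a b /sE ab; apply: connect1.
rewrite -(@card_in_imset _ _ (root (adj H))) => [|x y].
  apply/subset_leq_card/subsetP=> _ /imsetP[x + ->].
  rewrite !inE -eqV root_vertices (root_root (@connect_adj_sym H)).
  by case/andP=> ->; rewrite eqxx.
rewrite !inE => /andP[_ /eqP rx] /andP[_ /eqP ry] /eqP.
rewrite (root_connect (@connect_adj_sym H)) => /sub.
rewrite -(root_connect (@connect_adj_sym G)).
by rewrite rx ry => /eqP.
Qed.

Lemma vertices_induced G A : vertices (induced G A) = vertices G :&: A.
Proof. by []. Qed.

Lemma vertices_del G v : vertices (del_vertex G v) = vertices G :\ v.
Proof. by rewrite vertices_induced setDE. Qed.

Lemma spanning_is_block H G :
  subgraph H G -> vertices H = vertices G -> is_block H -> is_block G.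
Proof.
case/andP=> _ sE eqV /andP[/eqP cH /forallP nH].
have G1 : ncomponents G = 1.
  apply/eqP; rewrite eqn_leq -{1}cH leq_ncomponents //=.
  by rewrite ncomponents_gt0 -eqV -ncomponents_gt0 cH.
rewrite /is_block /connected_graph G1 eqxx /=; apply/forallP=> v.
have := nH v; rewrite /cut_vertex eqV cH G1; case: (v \in _) => //=.
rewrite -!leqNgt; apply: leq_trans; apply: leq_ncomponents.
  by rewrite !vertices_del eqV.
apply/subsetP=> p; rewrite !inE => /andP[pE ->]; rewrite andbT.
exact: (subsetP sE).
Qed.

Lemma card_del G v :
  v \in vertices G -> #|vertices (del_vertex G v)| < #|vertices G|.
Proof. by move=> vG; rewrite vertices_del [X in _ < X](cardsD1 v) vG. Qed.

Lemma card_block G B :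
  ~~ is_block G -> B \in blocks G -> #|vertices B| < #|vertices G|.
Proof.
move=> nG; rewrite inE => /and3P[sBG bB _]; have /andP[sV _] := sBG.
apply: proper_card; rewrite properEneq sV andbT.
by apply: contraNneq nG => eqV; apply: spanning_is_block bB.
Qed.

Lemma bigmin_geq A (f : T -> nat) i m :
  (m <= \big[minn/i]_(v in A) f v) = (m <= i) && [forall (v | v \in A), m <= f v].
Proof.
rewrite -big_andE.
rewrite unlock; elim: (index_enum T) => [|v s IHs] /=; first by rewrite andbT.
by case: ifP => // _; rewrite leq_min IHs andbCA.
Qed.

Lemma bigmin_idx A (f : T -> nat) v0 v1 : v0 \in A -> v1 \in A ->
  \big[minn/f v0]_(v in A) f v = \big[minn/f v1]_(v in A) f v.
Proof.
have le a b : b \in A ->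
    \big[minn/f a]_(v in A) f v <= \big[minn/f b]_(v in A) f v.
  move=> bA; rewrite bigmin_geq.
  have := leqnn (\big[minn/f a]_(v in A) f v).
  rewrite {1}bigmin_geq => /andP[_ h]; rewrite h andbT.
  by move/forall_inP: h; apply.
by move=> A0 A1; apply/eqP; rewrite eqn_leq !le.
Qed.

Lemma td2_recE d G : #|vertices G| <= d -> td2_rec d G = td2 G.
Proof.
suff main n : forall d d' G, #|vertices G| <= n -> n <= d -> n <= d' ->
    td2_rec d G = td2_rec d' G by move=> h; apply: main h _.
elim: n => [|n IH] {}d d' {}G.
  rewrite leqn0 cards_eq0 => /eqP G0 _ _.
  have td0 e : td2_rec e G = 0.
    by case: e => //= e; case: pickP => // v; rewrite G0 inE.
  by rewrite !td0.
case: d d' => [|d] [|d'] // cG nd nd' /=; case: pickP => // v0 v0G.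
have del v : v \in vertices G ->
    td2_rec d (del_vertex G v) = td2_rec d' (del_vertex G v).
  by move=> vG; apply: IH => //; rewrite -ltnS (leq_trans (card_del vG)).
case: ifP => [_|/negbT nG]; first by rewrite del //; congr _.+1; apply: eq_bigr.
apply: eq_bigr => B BG; apply: IH => //.
by rewrite -ltnS (leq_trans (card_block nG BG)).
Qed.

Lemma is_block_nonnull G : is_block G -> vertices G != set0.
Proof.
by case/andP=> /eqP cG _; rewrite -ncomponents_gt0 cG.
Qed.

Lemma subgraph_refl G : subgraph G G.
Proof. by rewrite /subgraph !subxx. Qed.

Theorem td2_null G : vertices G = set0 -> td2 G = 0.
Proof. by move=> G0; rewrite /td2 G0 cards0. Qed.

Theorem td2_block G v0 : is_block G -> v0 \in vertices G ->
  td2 G = (\big[minn/td2 (del_vertex G v0)]_(v in vertices G)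
             td2 (del_vertex G v)).+1.
Proof.
move=> bG v0G; rewrite -(@td2_recE #|vertices G|.+1) //=.
case: pickP => [v1 v1G|/(_ v0)]; last by rewrite v0G.
have del v : v \in vertices G ->
    td2_rec #|vertices G| (del_vertex G v) = td2 (del_vertex G v).
  by move=> vG; rewrite td2_recE // ltnW ?card_del.
rewrite bG del // (eq_bigr (fun v => td2 (del_vertex G v))) //.
by rewrite (@bigmin_idx _ (fun v => td2 (del_vertex G v)) v1 v0).
Qed.

Theorem td2_blocks G : 1 < #|blocks G| -> td2 G = \max_(B in blocks G) td2 B.
Proof.
move=> G2; have nG : ~~ is_block G.
  apply: contraTN G2 => bG; rewrite -leqNgt -(cards1 G).
  apply/subset_leq_card/subsetP=> B; rewrite !inE => /and3P[sB _].
  by move=> /forallP/(_ G); rewrite subgraph_refl bG sB /= eq_sym.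
have [B0 B0G] : exists B, B \in blocks G by apply/card_gt0P; apply: ltnW.
rewrite -(@td2_recE #|vertices G|.+1) //= (negPf nG).
case: pickP => [v1 _|G0].
  by apply: eq_bigr => B BG; rewrite td2_recE // ltnW ?card_block.
have := card_block nG B0G; suff -> : vertices G = set0 by rewrite cards0.
by apply/setP=> x; rewrite G0 inE.
Qed.

(* The cases of the null graph, a block, and a graph with several blocks are
   exhaustive. *)
Theorem blocks_gt1 G :
  vertices G != set0 -> ~~ is_block G -> 1 < #|blocks G|.
Proof.
move=> /set0Pn[x0 x0G] nG.
pose K x : sgraph T := induced G [set x].
have VK x : x \in vertices G -> vertices (K x) = [set x].
  by move=> xG; apply/setP=> y; rewrite !inE andb_idl // => /eqP->.
have cover x : x \in vertices G -> exists2 B, B \in blocks G & x \in vertices B.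
  move=> xG; pose P B := [&& subgraph B G, is_block B & x \in vertices B].
  have PK : P (K x).
    apply/and3P; split; last by rewrite VK ?inE.
      apply/andP; split; apply/subsetP=> p; rewrite !inE.
        by case/andP.
      by case/andP.
    have subK A : ncomponents (induced (K x) A) <= 1.
      rewrite ncomponentsE -(cards1 x).
      apply/subset_leq_card/subsetP=> y.
      by case/setIdP; rewrite vertices_induced VK // => /setIP[].
    have K1 : ncomponents (K x) = 1.
      apply/eqP; rewrite eqn_leq ncomponents_gt0 VK // ncomponentsE -{1}(cards1 x).
      rewrite subset_leq_card; first by apply/set0Pn; exists x; rewrite inE.
      by apply/subsetP=> y; rewrite VK // => /setIdP[].
    rewrite /is_block /connected_graph K1 eqxx /=; apply/forallP=> v.
    by rewrite /cut_vertex K1 negb_and -leqNgt subK orbT.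
  pose sz B := #|vertices B| + #|edges B|.
  case: (@arg_maxnP _ (K x) P sz PK) => B /and3P[sB bB xB] maxB.
  exists B => //; rewrite inE sB bB /=; apply/forallP=> B'; apply/implyP.
  case/and3P=> sB' bB' /andP[sV sE].
  have := maxB B'; rewrite /P sB' bB' (subsetP sV) // => /(_ isT) le.
  have [cV cE] := (subset_leq_card sV, subset_leq_card sE).
  have eV : vertices B = vertices B'.
    apply/eqP; rewrite eqEcard sV -(leq_add2r #|edges B'|).
    exact: leq_trans le (leq_add _ _).
  have eE : edges B = edges B'.
    apply/eqP; rewrite eqEcard sE -(leq_add2l #|vertices B'|).
    exact: leq_trans le (leq_add _ _).
  rewrite -val_eqE /=; move: eV eE; rewrite /vertices /edges.
  by case: (sgraph_val B) (sgraph_val B') => [a b] [c d] /= -> ->.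
have [B BG _] := cover _ x0G; rewrite ltnNge; apply/negP=> le1.
have sub B' : B' \in blocks G -> B' = B.
  by move=> B'G; apply: (card_le1_eqP le1).
have /andP[sV _] : subgraph B G by move: BG; rewrite inE => /and3P[].
have := card_block nG BG; rewrite ltnNge => /negP; apply.
by apply/subset_leq_card/subsetP=> x /cover[B' /sub->].
Qed.

End Graphs.

Definition isomorphic (T U : finType) (H : sgraph T) (K : sgraph U) : Prop :=
  exists f : {x : T | x \in vertices H} -> {y : U | y \in vertices K},
    bijective f /\
    forall x y, adj K (val (f x)) (val (f y)) = adj H (val x) (val y).

Definition contains_subgraph (T U : finType) (G : sgraph T) (H : sgraph U) :=
  exists K : sgraph T, subgraph K G /\ isomorphic H K.

Definition contains_induced (T U : finType) (G : sgraph T) (H : sgraph U) :=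
  exists A : {set T}, A \subset vertices G /\ isomorphic H (induced G A).

Fact path_graph_axiom n :
  sgraph_axiom ([set: 'I_n],
    [set p : 'I_n * 'I_n | (p.1.+1 == p.2 :> nat) || (p.2.+1 == p.1 :> nat)]).
Proof.
apply/forallP=> x; apply/forallP=> y; apply/implyP; rewrite !inE /= orbC => xy.
by rewrite xy andbT; apply: contraTneq xy => ->; rewrite orbb gtn_eqF.
Qed.

Definition path_graph n : sgraph 'I_n := SGraph (path_graph_axiom n).

(* Main.v *)
(* Let l be the maximal order of an induced path.  By induction on k, a path in
   a graph with td2 <= k has order at most N_k, where N_0 = 0 and
   N_(k+1) = 1 + 2 (l - 1) N_k, whence N_k <= (2 l)^(k-1).  A block has a vertex
   v whose deletion lowers td2, and v splits a path of the block into two pieces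
   of order at most N_k, so this path has length at most 2 N_k.  In general,
   cutting at the vertices that separate its ends x and y decomposes a path into
   pieces that each lie in one block, and a shortest x-y path, which is induced
   and so has length at most l - 1, has length at least the number of pieces. *)
Require Import Defs.
From mathcomp Require Import all_boot all_order all_algebra.
From mathcomp Require Import boolp reals exp.

Import Order.TTheory GRing.Theory Num.Theory.

Set Implicit Arguments.
Unset Strict Implicit.
Unset Printing Implicit Defensive.

Section InducedPaths.
Variable T : finType.
Implicit Types (G H B : sgraph T) (A : {set T}) (v w x y z : T) (p q s : seq T).

(** * Adjacency, paths and induced subgraphs *)

Lemma adj_induced G A x y :
  adj (induced G A) x y = [&& adj G x y, x \in A & y \in A].
Proof. by rewrite /adj /edges /= inE. Qed.

Lemma adj_sym G x y : adj G x y = adj G y x.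
Proof. by apply/idP/idP => /adj_vertices/and4P[]. Qed.

Lemma path_induced G A x p :
  path (adj (induced G A)) x p = path (adj G) x p && (nilp p || all (mem A) (x :: p)).
Proof.
elim: p x => //= y p IH x; rewrite IH adj_induced /=.
by case: p {IH} => [|z p] /=; case: (adj G x y); case: (x \in A); case: (y \in A);
  rewrite ?andbT ?andbF //=.
Qed.

Lemma sorted_induced G A s :
  {subset s <= A} -> sorted (adj (induced G A)) s = sorted (adj G) s.
Proof.
by case: s => //= x p sA; rewrite path_induced (introT allP) ?orbT ?andbT.
Qed.

Lemma path_vertices G x p :
  x \in vertices G -> path (adj G) x p -> {subset x :: p <= vertices G}.
Proof.
elim: p x => [|y p IH] x xG /=; first by move=> _ z; rewrite inE => /eqP->.
case/andP=> /adj_vertices/and4P[_ yG _ _] yp z; rewrite inE => /predU1P[-> //|].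
exact: IH.
Qed.

Lemma sgraph_eq H G :
  vertices H = vertices G -> edges H = edges G -> H = G.
Proof.
move=> eV eE; apply: val_inj => /=; move: eV eE; rewrite /vertices /edges.
by case: (sgraph_val H) (sgraph_val G) => [a b] [c d] /= -> ->.
Qed.

Lemma subgraph_trans H B G : subgraph H B -> subgraph B G -> subgraph H G.
Proof.
by move=> /andP[a b] /andP[c d]; rewrite /subgraph (subset_trans a c) (subset_trans b d).
Qed.

Lemma subgraph_induced G A : subgraph (induced G A) G.
Proof.
by apply/andP; split; apply/subsetP=> z; rewrite !inE => /andP[].
Qed.

(** * Blocks and their 2-treedepth *)

(** Among the subgraphs of [G] above [H] that satisfy [is_block], one with the most vertices plus
    edges is maximal for inclusion, as nested subgraphs with equal counts coincide. *)
Lemma block_extend G H :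
  subgraph H G -> is_block H -> exists2 B, B \in blocks G & subgraph H B.
Proof.
move=> sHG bH; pose P B := [&& subgraph B G, is_block B & subgraph H B].
have PH : P H by rewrite /P sHG bH subgraph_refl.
pose sz B := #|vertices B| + #|edges B|.
case: (@arg_maxnP _ H P sz PH) => B /and3P[sB bB HB] maxB.
exists B => //; rewrite inE sB bB /=; apply/forallP=> B'; apply/implyP.
case/and3P=> sB' bB' sBB'; have /andP[sV sE] := sBB'.
have := maxB B'; rewrite /P sB' bB' (subgraph_trans HB sBB') => /(_ isT) le.
have [cV cE] := (subset_leq_card sV, subset_leq_card sE).
have eV : vertices B = vertices B'.
  apply/eqP; rewrite eqEcard sV -(leq_add2r #|edges B'|).
  exact: leq_trans le (leq_add _ _).
have eE : edges B = edges B'.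
  apply/eqP; rewrite eqEcard sE -(leq_add2l #|vertices B'|).
  exact: leq_trans le (leq_add _ _).
by apply/eqP/sgraph_eq.
Qed.

(** Extra edges on the same vertices create no cut-vertex, so the subgraph induced on [vertices B]
    also satisfies [is_block], and maximality equates it with [B]. *)
Lemma adj_block G B x y : B \in blocks G ->
  x \in vertices B -> y \in vertices B -> adj B x y = adj G x y.
Proof.
rewrite inE => /and3P[/andP[sV sE] bB /forallP/(_ (induced G (vertices B)))] maxB.
have eV : vertices B = vertices (induced G (vertices B)).
  by rewrite vertices_induced; apply/esym/setIidPr.
have sBI : subgraph B (induced G (vertices B)).
  rewrite /subgraph -eV subxx; apply/subsetP=> -[a b] ab.
  have /and4P[aB bB' _ _] := @adj_vertices _ B a b ab.
  by rewrite !inE /= aB bB' (subsetP sE).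
move: maxB; rewrite subgraph_induced sBI.
rewrite (spanning_is_block sBI eV bB) /= => /eqP eB xB yB.
by have := adj_induced G (vertices B) x y; rewrite eB xB yB !andbT.
Qed.

Lemma td2_block_le G B : B \in blocks G -> td2 B <= td2 G.
Proof.
move=> BG; have := BG; rewrite inE => /and3P[sBG bB /forallP/(_ G)].
rewrite subgraph_refl sBG andbT /= => maxB.
have [bG|nG] := boolP (is_block G); first by move: maxB; rewrite bG => /eqP->.
rewrite (@td2_blocks _ G); first exact: leq_bigmax_cond.
apply: blocks_gt1 nG; apply: contraNneq (is_block_nonnull bB) => G0.
by rewrite -subset0 -G0; case/andP: sBG.
Qed.

(** The minimum over deleted vertices is attained. The conjunct [0 < k] settles the base case of the
    final induction. *)
Lemma td2_block_del B k : is_block B -> td2 B <= k ->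
  exists v, [/\ v \in vertices B, 0 < k & td2 (del_vertex B v) <= k.-1].
Proof.
move=> bB; have /set0Pn[v0 v0B] := is_block_nonnull bB.
rewrite (td2_block bB v0B); case: k => // k; rewrite ltnS => le.
have [/existsP[v /andP[vB lev]]|] :=
  boolP [exists v, (v \in vertices B) && (td2 (del_vertex B v) <= k)].
  by exists v.
rewrite negb_exists => /forallP no; suff: k.+1 <= k by rewrite ltnn.
apply: leq_trans le; rewrite bigmin_geq.
have ge v : v \in vertices B -> k < td2 (del_vertex B v).
  by move=> vB; have := no v; rewrite vB -ltnNge.
by rewrite ge //; apply/forall_inP.
Qed.

(** * Connectedness and separating vertices *)

Lemma ncomponents_le1 G :
  {in vertices G &, forall x y, connect (adj G) x y} -> ncomponents G <= 1.
Proof.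
move=> con; rewrite ncomponentsE; apply/card_le1_eqP => x y.
rewrite !inE => /andP[xG /eqP rx] /andP[yG /eqP ry].
rewrite -rx -ry; apply/eqP; rewrite (root_connect (@connect_adj_sym _ G)).
exact: con.
Qed.

(** The pairwise form of connectedness holds vacuously for the null graph, which is what remains
    after deleting an only vertex. *)
Lemma is_block_connect G x : x \in vertices G ->
  {in vertices G &, forall y z, connect (adj G) y z} ->
  (forall w, {in vertices (del_vertex G w) &,
     forall y z, connect (adj (del_vertex G w)) y z}) ->
  is_block G.
Proof.
move=> xG con cond.
have G1 : ncomponents G = 1.
  apply/eqP; rewrite eqn_leq ncomponents_le1 // ncomponents_gt0.
  by apply/set0Pn; exists x.
rewrite /is_block /connected_graph G1 eqxx; apply/forallP=> w.
by rewrite /cut_vertex G1 negb_and -leqNgt ncomponents_le1 ?orbT.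
Qed.

Lemma connect_induced G A x p : path (adj G) x p ->
  {subset x :: p <= A} -> connect (adj (induced G A)) x (last x p).
Proof.
move=> xp sA; apply/connectP; exists p => //.
by rewrite path_induced xp (introT allP) ?orbT.
Qed.

(* When no vertex other than x and y separates them, the vertices that lie on
   simple x-y paths induce a graph without cut-vertex: removing w cuts such a
   path into at most two pieces, each still attached to x or to y. *)
Lemma upath_in_block G x p : x \in vertices G -> path (adj G) x p ->
  uniq (x :: p) ->
  (forall w, w != x -> w != last x p ->
     connect (adj (del_vertex G w)) x (last x p)) ->
  exists2 B, B \in blocks G & {subset x :: p <= vertices B}.
Proof.
move=> xG; set y := last x p => xp Up nosep.
pose upath q := [/\ path (adj G) x q, uniq (x :: q) & last x q = y].
pose A := [set z | `[< exists2 q, upath q & z \in x :: q >]].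
have inA q : upath q -> {subset x :: q <= A}.
  by move=> uq z zq; rewrite inE; apply/asboolP; exists q.
have up : upath p by [].
have VH : vertices (induced G A) = A.
  rewrite vertices_induced; apply/setIidPr/subsetP=> z.
  by rewrite inE => /asboolP[q [xq _ _]]; apply: path_vertices.
have [B BG sHB] : exists2 B, B \in blocks G & subgraph (induced G A) B.
  apply: block_extend; first exact: subgraph_induced.
  have xA : x \in A by apply: (inA p); rewrite ?mem_head.
  apply: (@is_block_connect _ x); rewrite ?VH //.
    suff conx z : z \in A -> connect (adj (induced G A)) x z.
      move=> a b /conx xa /conx; apply: connect_trans.
      by rewrite connect_adj_sym.
    rewrite [in X in X -> _]inE => /asboolP[q uq /splitPl eq].
    case: eq uq => q1 q2 <- uq; have [] := uq; rewrite cat_path => /andP[xq1 _] _ _.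
    apply: connect_induced => // a aq; apply: inA uq _ _.
    by rewrite -cat_cons mem_cat aq.
  move=> w; set D := del_vertex _ w.
  have VD : vertices D = A :\ w by rewrite /D vertices_del VH.
  have conD a q : path (adj G) a q -> {subset a :: q <= A} -> w \notin a :: q ->
      connect (adj D) a (last a q).
    move=> aq sA wq; apply: connect_induced.
      by rewrite path_induced aq (introT allP) ?orbT.
    by move=> b bq; rewrite !inE; apply: contraNneq wq => <-.
  (* On a simple path through [z], [w] lies on at most one side of [z]; the other side joins [z] to
     an end within [D]. *)
  have ends z : z \in A -> z != w ->
      (w != x) && connect (adj D) x z || (w != y) && connect (adj D) y z.
    rewrite inE => /asboolP[q uq /splitPl eq] zw.
    case: eq zw uq => q1 q2 lz zw uq; have := inA _ uq.
    case: uq => + + <-; rewrite -cat_cons cat_uniq cat_path last_cat.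
    rewrite lz => /andP[xq1 zq2] /and3P[_ dis _] sA.
    have [wq1|wq1] := boolP (w \in x :: q1).
      have wq2 : w \notin z :: q2.
        rewrite inE negb_or eq_sym zw; apply: contra dis => wq2.
        by apply/hasP; exists w.
      apply/orP; right; rewrite connect_adj_sym conD //.
        by rewrite andbT; apply: contraNneq wq2 => ->; rewrite mem_last.
      move=> a; rewrite inE => /predU1P[->|aq2]; apply: sA; rewrite mem_cat.
        by rewrite -lz mem_last.
      by rewrite aq2 orbT.
    apply/orP; left; rewrite -lz conD // ?andbT.
      by apply: contraNneq wq1 => ->; rewrite mem_head.
    by move=> a aq; apply: sA; rewrite mem_cat aq.
  (* The walk avoiding [w] given by [nosep], shortened to a simple path, is one of the paths making
     up [A], hence stays in [D]. *)
  have conxy : w != x -> w != y -> connect (adj D) x y.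
    move=> wx wy; have /connectP[q xq] := nosep w wx wy.
    case: (shortenP xq) => r + Ur _ lr; rewrite path_induced => /andP[xr wr].
    have sA : {subset x :: r <= A} by apply: inA; split.
    rewrite -/y in lr; rewrite lr; apply: conD => //.
    case/orP: wr => [/nilP r0|/allP wr]; first by rewrite r0 inE.
    by apply/negP=> /wr; rewrite !inE eqxx.
  have conx z : z \in A -> z != w -> w != x -> connect (adj D) x z.
    move=> zA zw wx; case/orP: (ends z zA zw) => /andP[wy] //.
    by apply: connect_trans; apply: conxy.
  move=> a b; rewrite VD => /setD1P[aw aA] /setD1P[bw bA].
  (* All vertices are linked through [x] if it survives, and through [y] if [x] is the deleted
     vertex. *)
  have [wx|wx] := eqVneq w x; last first.
    apply: connect_trans (conx b _ bw wx) => //.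
    by rewrite connect_adj_sym; apply: conx.
  have cony z : z \in A -> z != w -> connect (adj D) y z.
    by move=> zA zw; have := ends z zA zw; rewrite -{1}wx eqxx /= => /andP[].
  by apply: connect_trans (cony b bA bw); rewrite connect_adj_sym cony.
exists B => // z zp; case/andP: sHB => /subsetP sV _; apply: sV.
by rewrite VH; apply: inA zp.
Qed.

(* A vertex separating the ends of p lies on both p and q, and cutting there
   adds up the lengths on both sides. *)
Lemma upath_walk_bound G c :
  (forall x p B, B \in blocks G -> {subset x :: p <= vertices B} ->
     path (adj G) x p -> uniq (x :: p) -> size p <= c) ->
  forall x p q, x \in vertices G -> path (adj G) x p -> uniq (x :: p) ->
    path (adj G) x q -> last x q = last x p -> size p <= size q * c.
Proof.
move=> bnd x p; have [n] := ubnP (size p); elim: n x p => // n IH x p.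
rewrite ltnS => le_pn q xG xp Up xq eqpq.
have [/existsP[w /and3P[wx wy sep]]|] := boolP [exists w,
    [&& w != x, w != last x p & ~~ connect (adj (del_vertex G w)) x (last x p)]].
  have inw r : path (adj G) x r -> last x r = last x p -> w \in r.
    move=> xr er; apply: contraR sep => wr; rewrite -er.
    apply: connect_induced => // a ar; rewrite !inE; apply: contraTneq ar => ->.
    by rewrite inE negb_or wx wr.
  have wp := inw p xp erefl; have wq := inw q xq eqpq.
  case/splitPr: p / wp le_pn xp Up eqpq wy {sep inw} => p1 p2 le_pn xp Up eqpq wy.
  case/splitPr: q / wq xq eqpq => q1 q2.
  move: xp wy; rewrite -!cat_rcons !last_cat !last_rcons !cat_path !last_rcons.
  move=> /andP[xp1 wp2] wy /andP[xq1 wq2] eqpq; rewrite !size_cat mulnDl.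
  have wG : w \in vertices G.
    by apply: (path_vertices xG xp1); rewrite inE mem_rcons mem_head orbT.
  move: Up le_pn; rewrite -cat_rcons -cat_cons cat_uniq size_cat => /and3P[Up1 dis Up2].
  (* As [w] is not the end of the path, the first piece is strictly shorter and the induction
     hypothesis applies to it. *)
  have p2_gt0 : 0 < size p2 by case: (p2) wy => //=; rewrite eqxx.
  move=> le_pn; apply: leq_add.
    apply: IH (xG) xp1 Up1 xq1 _; last by rewrite !last_rcons.
    by apply: leq_trans le_pn; rewrite -addn1 leq_add2l.
  apply: IH wG wp2 _ wq2 eqpq.
    by apply: leq_trans le_pn; rewrite size_rcons addSn ltnS leq_addl.
  rewrite /= Up2 andbT; apply: contra dis => wp2'; apply/hasP; exists w => //=.
  by rewrite inE mem_rcons mem_head orbT.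
rewrite negb_exists => /forallP nosep.
have [B BG sB] : exists2 B, B \in blocks G & {subset x :: p <= vertices B}.
  apply: upath_in_block => // w wx wy.
  by have := nosep w; rewrite wx wy negbK.
(* With [p] inside one block, [c] bounds its length, and it remains to see that [q] is nonempty: a
   nonempty simple path does not end at [x]. *)
have [-> //|p_gt0] := posnP (size p).
apply: leq_trans (bnd _ _ _ BG sB xp Up) (leq_pmull _ _).
case: q {xq} eqpq => //= xl.
case: p Up p_gt0 xl {bnd IH le_pn xp nosep sB} => //= a p /andP[xp _] _ xl.
by move: xp; rewrite xl mem_last.
Qed.

(** * Induced paths as vertex sequences *)

(** The adjacency condition copies the edge relation of [path_graph]; quantifying over ordinals
    keeps it boolean. *)
Definition induced_path G s :=
  [&& uniq s, all (mem (vertices G)) s & [forall i : 'I_(size s), forall j : 'I_(size s),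
     adj G (tnth (in_tuple s) i) (tnth (in_tuple s) j)
       == (i.+1 == j :> nat) || (j.+1 == i :> nat)]].

Lemma induced_path_nth G s x0 :
  uniq s -> {subset s <= vertices G} ->
  (forall i j, i < j < size s -> adj G (nth x0 s i) (nth x0 s j) = (i.+1 == j)) ->
  induced_path G s.
Proof.
move=> Us sG adjs; apply/and3P; split=> //; first exact/allP.
apply/forallP=> i; apply/forallP=> j; rewrite !(tnth_nth x0) /=.
case: (ltngtP i j) => [ij|ji|/val_inj->].
- by rewrite adjs ?ij ?ltn_ord // (@gtn_eqF i j.+1) ?orbF // ltnS ltnW.
- by rewrite adj_sym adjs ?ji ?ltn_ord // (@gtn_eqF j i.+1) // ltnS ltnW.
- rewrite orbb gtn_eqF //; apply/eqP/negbTE/negP=> /adj_vertices/and4P[_ _].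
  by rewrite eqxx.
Qed.

Lemma induced_path_induced G A s :
  induced_path (induced G A) s -> induced_path G s.
Proof.
case/and3P=> Us /allP sA /forallP adjs; apply/and3P; split=> //.
  by apply/allP=> z /sA; rewrite /= inE => /andP[].
apply/forallP=> i; apply/forallP=> j; have /forallP/(_ j) := adjs i.
rewrite adj_induced; have inA l : tnth (in_tuple s) l \in A.
  by have /sA := mem_tnth l (in_tuple s); rewrite /= inE => /andP[].
by rewrite !inA !andbT.
Qed.

Lemma induced_path_block G B s :
  B \in blocks G -> induced_path B s -> induced_path G s.
Proof.
move=> BG /and3P[Us /allP sB /forallP adjs].
have /subsetP sV : vertices B \subset vertices G.
  by move: BG; rewrite inE => /and3P[/andP[]].
apply/and3P; split=> //; first by apply/allP=> b /sB /sV.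
apply/forallP=> i; apply/forallP=> j; have /forallP/(_ j) := adjs i.
by rewrite (adj_block BG) //; apply/sB/mem_tnth.
Qed.

(** A walk of minimal length between the two ends is simple, and a chord would shorten it. *)
Lemma shortest_walk G x p : x \in vertices G -> path (adj G) x p ->
  exists q, [/\ path (adj G) x q, last x q = last x p & induced_path G (x :: q)].
Proof.
move=> xG xp; set y := last x p.
pose walk m := [exists q : m.-tuple T, path (adj G) x q && (last x q == y)].
have ex_walk : exists m, walk m.
  by exists (size p); apply/existsP; exists (in_tuple p); rewrite xp /= eqxx.
case: (ex_minnP ex_walk) => m /existsP[q0 /andP[xq0 /eqP ly]] min_m.
have min_q q : path (adj G) x q -> last x q = y -> m <= size q.
  move=> xq lq; apply: min_m; apply/existsP; exists (in_tuple q).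
  by rewrite xq lq eqxx.
have [q [xq lq Uq sq]] :
    exists q, [/\ path (adj G) x q, last x q = y, uniq (x :: q) & size q = m].
  move: ly; case: (shortenP xq0) => q xq Uq qsub lq.
  exists q; split=> //; apply/eqP; rewrite eqn_leq min_q // andbT.
  rewrite -(size_tuple q0); apply: uniq_leq_size => //; first by case/andP: Uq.
exists q; split=> //; apply: (@induced_path_nth _ _ x) => //.
  exact: path_vertices.
move=> i [//|j]; rewrite ltnS /= ltnS => /andP[ij jq].
have adjn l : l < size q -> adj G (nth x (x :: q) l) (nth x q l).
  by move=> lq'; have /(pathP x) := xq; apply.
rewrite eqSS; have [->|nij] := eqVneq i j; first by rewrite adjn.
apply/negbTE/negP=> aij; have {nij}ij' : i < j by rewrite ltn_neqAle nij.
have iq : i <= size q by apply: leq_trans ij (ltnW jq).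
have eli : last x (take i q) = nth x (x :: q) i.
  by rewrite (last_nth x) size_takel //; case: (i) => //= l; rewrite nth_take.
(* The chord joins positions [i] and [j.+1] of [x :: q]; the latter is position [j] of [q], so the
   shortcut has length [i + (size q - j)]. *)
have := min_q (take i q ++ drop j q).
rewrite size_cat size_takel // size_drop leqNgt -sq; have -> : i + (size q - j) < size q.
  by rewrite -[X in _ < X](subnKC (ltnW jq)) ltn_add2r.
have xq' := xq; rewrite -(cat_take_drop j q) cat_path in xq'.
rewrite cat_path last_cat eli (drop_nth x jq) /= aij.
have -> : path (adj G) x (take i q).
  by move: xq; rewrite -{1}(cat_take_drop i q) cat_path => /andP[].
move: xq'; rewrite (drop_nth x jq) /= => /and3P[_ _ ->].
suff -> : last (nth x q j) (drop j.+1 q) = y by move=> /(_ isT erefl).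
by rewrite -lq -{3}(cat_take_drop j q) last_cat (drop_nth x jq).
Qed.

(** * The bound on the order of paths *)

(** There are at most [l.-1] pieces, each of length at most [2 * path_bound l k']; the 1 turns
    length into order. *)
Fixpoint path_bound l k := if k is k'.+1 then 1 + l.-1 * (2 * path_bound l k') else 0.

(** With X = [(2 * l) ^ k], the product 2 l X exceeds 2 (l - 1) X by 2 X, which absorbs the 1. The
    exponent lags by one because the bound at index 1 is 1. *)
Lemma path_bound_leq l k : 0 < l -> path_bound l k.+1 <= (2 * l) ^ k.
Proof.
move=> l_gt0; elim: k => [|k IH]; first by rewrite /= !muln0.
rewrite -[path_bound l k.+2]/(1 + l.-1 * (2 * path_bound l k.+1)); apply: (@leq_trans (1 + l.-1 * (2 * (2 * l) ^ k))).
  by rewrite leq_add2l leq_mul2l leq_mul2l IH !orbT.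
case: l l_gt0 {IH} => // l _; rewrite /= expnS.
have : 0 < (2 * l.+1) ^ k by rewrite expn_gt0.
set X := _ ^ k => X0; rewrite mulnCA -[2 * l.+1 * X]mulnA mulSn mulnDr leq_add2r.
by rewrite muln_gt0.
Qed.

Lemma td2_path_bound l k G s : td2 G <= k ->
  (forall r, induced_path G r -> size r <= l) ->
  sorted (adj G) s -> uniq s -> {subset s <= vertices G} ->
  size s <= path_bound l k.
Proof.
elim: k G s => [|k IH] G [//|x p] Gk ind xp Up sG.
  (* For [k = 0] there can be no vertex [x]: the one-vertex path lies in some block, whose
     2-treedepth is positive. *)
  have xG : x \in vertices G by apply: sG; rewrite mem_head.
  have [B BG _] := @upath_in_block G x [::] xG isT isT (fun w _ _ => connect0 _ _).
  have bB : is_block B by move: BG; rewrite inE => /and3P[].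
  by have [v []] := td2_block_del bB (leq_trans (td2_block_le BG) Gk).
have xG : x \in vertices G by apply: sG; rewrite mem_head.
have [q [xq lq /ind]] := shortest_walk xG xp.
rewrite /= => ql; rewrite add1n ltnS.
apply: leq_trans (_ : size q * (2 * path_bound l k) <= _); last first.
  by rewrite leq_mul2r; case: (l) ql => // l' ql; rewrite ltnS in ql; rewrite ql orbT.
apply: upath_walk_bound xG xp Up xq lq => {x p q ql sG} x p B BG sB xp Up.
have bB : is_block B by move: BG; rewrite inE => /and3P[].
have [v [vB _ tdv]] := td2_block_del bB (leq_trans (td2_block_le BG) Gk).
(* A path of [B] avoiding [v] lives in [B - v], whose induced paths are induced in [G], so the same
   [l] serves in the induction. *)
have bnd s : sorted (adj G) s -> uniq s -> {subset s <= vertices B} ->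
    v \notin s -> size s <= path_bound l k.
  move=> Ss Us sVB vs.
  have sD : {subset s <= ~: [set v]}.
    by move=> b bs; rewrite !inE; apply: contraNneq vs => <-.
  apply: (IH (del_vertex B v)) => //.
  - move=> r /induced_path_induced Br; apply: ind; exact: induced_path_block BG Br.
  - rewrite (sorted_induced _ sD) -(eq_in_sorted (P := vertices B) (e := adj G)) //.
      by move=> a b aB bB'; rewrite (adj_block BG).
    by apply/allP.
  - by move=> b bs; rewrite inE sVB // sD.
have [vp|vp] := boolP (v \in x :: p); last first.
  have := bnd (x :: p) xp Up sB vp; rewrite /= => /ltnW /leq_trans; apply.
  by rewrite mul2n -addnn leq_addr.
(* The order of the path exceeds its length by one, which accounts for [v]: the length is the sum of
   the orders of the two pieces. *)
rewrite mul2n -addnn -ltnS -/(size (x :: p)).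
have Ss : sorted (adj G) (x :: p) by [].
move: (x :: p) vp Ss Up sB => s vs; case/splitPr: s / vs => s1 s2.
rewrite size_cat /= addnS ltnS cat_uniq /= => /cat_sorted2[Ss1 Svs2] /and3P[Us1 /norP[vs1 _]].
case/andP=> vs2 Us2 sB.
apply: leq_add; apply: bnd => //.
- by move=> b bs; apply: sB; rewrite mem_cat bs.
- exact: path_sorted Svs2.
- by move=> b bs; apply: sB; rewrite mem_cat inE bs !orbT.
Qed.

Lemma ex_longest_induced_path G : exists2 s, induced_path G s &
  forall r, induced_path G r -> size r <= size s.
Proof.
pose P m := [exists s : m.-tuple T, induced_path G s].
have P0 : exists m, P m.
  exists 0; apply/existsP; exists [tuple]; apply/and3P; split=> //.
  by apply/forallP=> -[].
have bndP m : P m -> m <= #|T|.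
  case/existsP=> s /and3P[Us _ _]; rewrite -(size_tuple s) -(card_uniqP Us).
  exact: max_card.
case: (ex_maxnP P0 bndP) => m /existsP[s Gs] max_m; exists s => // r Gr.
by rewrite size_tuple; apply: max_m; apply/existsP; exists (in_tuple r).
Qed.

(** * Between vertex sequences and copies of path graphs *)

Lemma contains_induced_path G s :
  induced_path G s -> contains_induced G (path_graph (size s)).
Proof.
case/and3P=> Us /allP sG /forallP adjs; pose A := [set z in s].
have VA : vertices (induced G A) = A.
  by rewrite vertices_induced; apply/setIidPr/subsetP=> z; rewrite inE => /sG.
exists A; split; first by rewrite -VA vertices_induced subsetIl.
have inA (i : 'I_(size s)) : tnth (in_tuple s) i \in vertices (induced G A).
  by rewrite VA inE mem_tnth.
pose f (i : {i | i \in vertices (path_graph (size s))}) :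
    {z | z \in vertices (induced G A)} := exist _ (tnth (in_tuple s) (val i)) (inA (val i)).
exists f; split.
  have inj_f : injective f.
    by move=> i j /(congr1 val) /(tuple_uniqP (in_tuple s) Us) /val_inj.
  apply: inj_card_bij => //; rewrite !card_sig.
  rewrite (eq_card (B := mem A)) => [|z]; last by rewrite unfold_in /= VA.
  rewrite cardsE (card_uniqP Us) -[X in X <= _]card_ord.
  by apply/subset_leq_card/subsetP=> z _; rewrite !inE.
move=> i j; rewrite adj_induced /= !inE !mem_tnth !andbT.
have /forallP/(_ (val j))/eqP -> := adjs (val i).
by rewrite /adj /edges /= inE.
Qed.

(** The copy need not be induced, so only adjacency of consecutive vertices is retained. *)
Lemma contains_path G n : contains_subgraph G (path_graph n) ->
  exists s, [/\ size s = n, sorted (adj G) s, uniq s & {subset s <= vertices G}].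
Proof.
case=> K [/andP[/subsetP sV /subsetP sE] [f [/bij_inj inj_f adj_f]]].
have inP (i : 'I_n) : i \in vertices (path_graph n) by rewrite inE.
pose g i : T := val (f (Sub i (inP i))).
have adj_g (i j : 'I_n) : i.+1 = j -> adj G (g i) (g j).
  move=> ij; apply: sE; rewrite -/(edges K) -/(adj K _ _) adj_f /=.
  by rewrite /adj /edges /= inE ij eqxx.
exists (map g (enum 'I_n)); split.
- by rewrite size_map size_enum_ord.
(* The case [n = 0] is separate because [nth] needs a default ordinal. *)
- case: n => [|n] in f inj_f adj_f inP g adj_g *.
    by have /eqP := size_enum_ord 0; rewrite -/(nilp _) => /nilP->.
  apply/(sortedP (g ord0)) => i; rewrite size_map size_enum_ord => lt_in.
  have nth_g j : j < n.+1 ->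
      nth (g ord0) (map g (enum 'I_n.+1)) j = g (nth ord0 (enum 'I_n.+1) j).
    by move=> lt_jn; rewrite (nth_map ord0) // size_enum_ord.
  rewrite !nth_g ?(ltnW lt_in) //; apply: adj_g.
  by rewrite !nth_enum_ord ?(ltnW lt_in).
- rewrite map_inj_uniq ?enum_uniq // => i j /val_inj /inj_f.
  by move/(congr1 val).
- by move=> z /mapP[i _ ->]; apply: sV; apply: valP.
Qed.

End InducedPaths.

Local Open Scope ring_scope.

Theorem theorem5 (R : realType) (k n : nat) (hk : (2 <= k)%N) (hn : (1 <= n)%N)
    (T : finType) (G : sgraph T) (hG : (td2 G <= k)%N)
    (hP : contains_subgraph G (path_graph n)) :
  exists m : nat,
    contains_induced G (path_graph m) /\
    n%:R `^ (1 / (k%:R - 1)) / 2 <= m%:R :> R.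
Proof.
have [s Gs max_s] := ex_longest_induced_path G.
exists (size s); split; first exact: contains_induced_path.
have [p [size_p Sp Up pG]] := contains_path hP.
have le_n : (n <= (2 * size s) ^ k.-1)%N.
  (* Since [n] is positive, [G] has a vertex, and the trivial walk there yields a nonempty induced
     path. *)
  have s_gt0 : (0 < size s)%N.
    case: p size_p Sp pG {Up} => [n0|x p _ _ pG]; first by rewrite -n0 in hn.
    have [q [_ _ /max_s]] := @shortest_walk _ G x [::] (pG x (mem_head _ _)) isT.
    exact: leq_trans.
  rewrite -size_p; apply: leq_trans (td2_path_bound hG max_s Sp Up pG) _.
  by case: k hk {hG} => // k _; apply: path_bound_leq.
have k1 : k%:R - 1 = k.-1%:R :> R.
  by rewrite -[in LHS](ltn_predK hk) -natr1 addrK.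
have k0 : k.-1%:R != 0 :> R by rewrite pnatr_eq0 -lt0n -ltnS (ltn_predK hk).
rewrite k1 div1r ler_pdivrMr ?ltr0n // mulrC -natrM.
set l := (2 * size s)%N.
(* Writing [l] as a (k-1)-th root reduces the goal to [le_n] by monotonicity of the power. *)
have -> : l%:R = (l ^ k.-1)%:R `^ k.-1%:R^-1 :> R.
  by rewrite natrX -powR_mulrn // -powRrM mulfV // powRr1.
by rewrite ge0_ler_powR ?nnegrE ?invr_ge0 ?ler0n // ler_nat.
Qed.
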